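(* Let $\Theta$ be a finite nonempty subset of $\mathbb Z$ and define $\mathcal D_\Theta=\bigcup_{\theta\in\Theta}\mathcal D_\theta$. Then the process $$J_n(\Theta)=\min_{\theta\in\Theta}J_n(\theta)$$ diverges to $\infty$ exponentially fast almost surely (that is, $\liminf_{n\to\infty}\frac1n\log J_n(\Theta)>0$ almost surely) when $X_1,X_2,\dots$ are i.i.d. with distribution $Q$, for every $Q\in\mathcal P(\mathbb Z)\setminus\mathcal D_\Theta$; and $(J_n(\Theta))$ is an e-process for $\mathcal D_\Theta$, i.e. an e-process when $X_1,X_2,\dots$ are i.i.d. with distribution $P$, for every $P\in\mathcal D_\Theta$.
   Context: $\mathcal P(\mathbb Z)$ is the set of probability measures on $\mathbb Z$; $f_P(n)=P(\{n\})$; $x^+=\max(x,0)$. For $\theta\in\mathbb Z$, the set of $\theta$-unimodal distributions is $$\mathcal D_\theta=\{P\in\mathcal P(\mathbb Z): f_P(n-1)\le f_P(n)\text{ if }n\le\theta,\ \text{and } f_P(n)\ge f_P(n+1)\text{ if }n\ge\theta\}.$$ A sequence of nonnegative statistics $M_n=M_n(X_1,\dots,X_n)$ is an e-process for a class $\mathcal P_0$ if for every $P\in\mathcal P_0$ and every (almost surely finite) stopping time $\tau$ of the filtration generated by $X_1,X_2,\dots$, one has $\mathbb E[M_\tau]\le1$ when $X_1,X_2,\dots$ are i.i.d. with distribution $P$. For a probability measure $R$ on $\mathbb Z$ and an integer $m\ge0$ define, for $x\in\mathbb Z$, $$E^{R,m}(x)=1+\lambda_{R,m}\big(-\mathbf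 1_{\{x=m\}}+\mathbf 1_{\{x=m+1\}}\big),\qquad \lambda_{R,m}=\frac{(f_R(m+1)-f_R(m))^+}{2(f_R(m)+f_R(m+1))},\quad 0/0:=0.$$ Let $\hat Q^{+,\theta}_k$ and $\hat Q^{-,\theta}_k$ be the empirical measures of $X_1-\theta,\dots,X_k-\theta$ and of $\theta-X_1,\dots,\theta-X_k$ respectively ($k\ge1$), and for $k=0$ interpret $E^{\hat Q^{\pm,\theta}_0,m}\equiv1$. Define $$J_n^{m+}(\theta)=\prod_{k=1}^nE^{\hat Q^{+,\theta}_{k-1},m}(X_k-\theta),\quad J_n^{m-}(\theta)=\prod_{k=1}^nE^{\hat Q^{-,\theta}_{k-1},m}(\theta-X_k),\quad J_n(\theta)=\sum_{m=0}^\infty2^{-m-2}\big(J_n^{m+}(\theta)+J_n^{m-}(\theta)\big).$$ *)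

(* Defs.v *)
From HB Require Import structures.
From mathcomp Require Import all_boot all_order all_algebra finmap.
From mathcomp Require Import all_classical all_reals all_analysis.

Set Implicit Arguments.
Unset Strict Implicit.
Unset Printing Implicit Defensive.

Import Order.TTheory GRing.Theory Num.Theory.
Import numFieldNormedType.Exports.

Local Open Scope classical_set_scope.
Local Open Scope ring_scope.

HB.instance Definition _ := isPointed.Build int 0.

HB.instance Definition _ := @isMeasurable.Build default_measure_display
  int discrete_measurable discrete_measurable0
  discrete_measurableC discrete_measurableU.

Definition mass (R : realType) (mu : {measure set int -> \bar R}) (n : int) : R :=
  fine (mu [set n]).

Definition unimodal (R : realType) (theta : int) : set (probability int R) :=
  [set P | (forall n : int, n <= theta -> mass P (n - 1) <= mass P n) /\
           (forall n : int, theta <= n -> mass P (n + 1) <= mass P n)].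

Definition unimodal_mode_in (R : realType) (Theta : {fset int}) :
    set (probability int R) :=
  \bigcup_(theta in [set` Theta]) @unimodal R theta.

Section iid.
Context d (T : measurableType d) (R : realType) (Pr : probability T R).
Implicit Type X : nat -> {RV Pr >-> int}.

Definition mutually_independent X : Prop :=
  forall (I : {fset nat}) (A : nat -> set int), (forall i, measurable (A i)) ->
    Pr (\bigcap_(i in [set` I]) (X i @^-1` A i)) =
    (\prod_(i <- I) Pr (X i @^-1` A i))%E.

Definition iid X (P : probability int R) : Prop :=
  mutually_independent X /\
  (forall i (A : set int), measurable A -> distribution Pr (X i) A = P A).

(* X is indexed from 0: the n-th sigma-algebra is generated by
   X 0, ..., X n.-1, and it is trivial for n = 0. *)
Definition natural_filtration X (n : nat) : set (set T) :=
  <<s \bigcup_(i in [set i | (i < n)%N])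
        preimage_set_system [set: T] (X i) measurable >>.

(* None stands for the value +oo *)
Definition stopping_time X (tau : T -> option nat) : Prop :=
  forall n, natural_filtration X n
    [set w | exists2 k, tau w = Some k & (k <= n)%N].

Definition sample X (n : nat) (w : T) : seq int := [seq X i w | i <- iota 0 n].

(* A sequence of statistics M_n(x_1, ..., x_n), n >= 0, is a single function M
   on finite sequences.  The value chosen on {tau = +oo} is irrelevant for an
   almost surely finite tau. *)
Definition stopped (M : seq int -> \bar R) X (tau : T -> option nat) (w : T)
    : \bar R :=
  if tau w is Some n then M (sample X n w) else 0%E.

End iid.

Definition e_process (R : realType) (C : set (probability int R))
    (M : seq int -> \bar R) : Prop :=
  (forall s, 0 <= M s)%E /\
  forall P, C P ->
  forall (d : measure_display) (T : measurableType d) (Pr : probability T R)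
    (X : nat -> {RV Pr >-> int}), iid X P ->
  forall tau : T -> option nat, stopping_time X tau ->
    {ae Pr, forall w, tau w != None} ->
    (\int[Pr]_w stopped M X tau w <= 1)%E.

Section J.
Context (R : realType).
Implicit Types (mu : {measure set int -> \bar R}) (m : nat) (y s : seq int).

(* 0 / 0 = 0 since 0^-1 = 0 *)
Definition bet_lambda mu m : R :=
  Num.max (mass mu (m%:Z + 1) - mass mu m%:Z) 0 /
  (2 * (mass mu m%:Z + mass mu (m%:Z + 1))).

Definition bet mu m (x : int) : R :=
  1 + bet_lambda mu m * (- (x == m%:Z)%:R + (x == m%:Z + 1)%:R).

Definition empirical y : {measure set int -> \bar R} :=
  mscale ((size y)%:R^-1)%:nng
    (msum (fun i => \d_(nth 0 y i) : {measure set int -> \bar R}) (size y)).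

Definition empirical_bet y m (x : int) : R :=
  if y is [::] then 1 else bet (empirical y) m x.

Definition wealth m y : R :=
  \prod_(k < size y) empirical_bet (take k y) m (nth 0 y k).

Definition J_plus (theta : int) m s : R := wealth m [seq x - theta | x <- s].

Definition J_minus (theta : int) m s : R := wealth m [seq theta - x | x <- s].

(* Extended-real-valued so that the series of nonnegative reals has a meaning
   without a convergence proof; since 1/2 <= bet <= 3/2 its value is a positive
   real number. *)
Definition J (theta : int) s : \bar R :=
  (\sum_(m <oo) (2 ^- (m + 2) * (J_plus theta m s + J_minus theta m s))%:E)%E.

Definition J_min (Theta : {fset int}) s : \bar R :=
  \big[mine/+oo%E]_(theta <- Theta) J theta s.

End J.

(* Main.v *)
(* A stopping-time event up to time n depends on the sample (x_1, ..., x_n) only,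
   and this takes countably many values, so independence reduces every expectation
   to one over the next observation.  For a theta-unimodal P, each bet moves
   money from a point to a less likely neighbour, so J_n(theta) is a nonnegative
   supermartingale started at 1; it dominates J_n(Theta) and optional stopping
   gives the e-process property.

   If Q is not theta-unimodal, some pair a, b of neighbours with
   Q(a) < Q(b) is bet on in the right direction.  Empirical frequencies converge
   (exponential moments have a summable expectation), hence so does the stake,
   to l = (Q(b) - Q(a)) / (2 (Q(a) + Q(b))), half the Kelly optimum.  The wealth
   then grows at a rate of at least Q(b) l / (1 + l) - Q(a) l / (1 - l) > 0, using
   1 + l >= exp(l / (1 + l)) and 1 - l >= exp(- l / (1 - l)). *)

Require Import Defs.
From HB Require Import structures.
From mathcomp Require Import all_boot all_order all_algebra finmap.
From mathcomp Require Import all_classical all_reals all_analysis.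
From mathcomp Require Import measurable_realfun zify lra ring.

Set Implicit Arguments.
Unset Strict Implicit.
Unset Printing Implicit Defensive.

Import Order.TTheory GRing.Theory Num.Theory.
Import numFieldNormedType.Exports.

Local Open Scope classical_set_scope.
Local Open Scope ring_scope.

Local Arguments sample : simpl never.

(** * Expectations over discrete samples *)

Section samples.
Context d (T : measurableType d) (R : realType) (Pr : probability T R).
Variable X : nat -> {RV Pr >-> int}.

Lemma measurable_value_preimage n (A : set int) : measurable (X n @^-1` A).
Proof. exact: measurable_funPTI. Qed.

Lemma sampleS n w : sample X n.+1 w = rcons (sample X n w) (X n w).
Proof. by rewrite /sample -addn1 iotaD map_cat cats1. Qed.

Lemma size_sample n w : size (sample X n w) = n.
Proof. by rewrite size_map size_iota. Qed.

Lemma measurable_sample_fiber n (s : seq int) :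
  measurable [set w | sample X n w = s].
Proof.
elim: n s => [|n IH] s.
  have [->|s0] := eqVneq s [::].
    by rewrite (_ : [set _ | _] = setT)//; apply/seteqP; split.
  rewrite (_ : [set _ | _] = set0)//; apply/seteqP; split=> // w /= h.
  by move: s0; rewrite -h.
case: (lastP s) => [|s' x].
  by rewrite (_ : [set _ | _] = set0)//; apply/seteqP; split.
rewrite (_ : [set _ | _] =
    [set w | sample X n w = s'] `&` (X n @^-1` [set x])).
  by apply: measurableI => //; exact: measurable_value_preimage.
apply/seteqP; split => w /=; rewrite sampleS.
  by move=> /rcons_inj [-> ->].
by move=> [-> ->].
Qed.

(** [seq int] is countable, so arbitrary sets of sequences are allowed here and every function of
    the sample is measurable. *)
Lemma measurable_sample_preimage n (S : set (seq int)) :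
  measurable (sample X n @^-1` S).
Proof.
rewrite (_ : _ @^-1` _ = \bigcup_s [set w | S s /\ sample X n w = s]).
  apply: countable_bigcupT_measurable => [|s]; first exact: countableP.
  have [Ss|nSs] := pselect (S s).
    rewrite (_ : [set _ | _] = [set w | sample X n w = s]).
      exact: measurable_sample_fiber.
    by apply/seteqP; split=> w //= [].
  by rewrite (_ : [set _ | _] = set0)//; apply/seteqP; split=> w //= [].
apply/seteqP; split => w /=; first by exists (sample X n w).
by move=> [s _ [Ss sE]]; rewrite sE.
Qed.

Lemma measurable_sample_fun n (D : set T) (h : seq int -> \bar R) :
  measurable_fun D (fun w => h (sample X n w)).
Proof.
move=> mD B mB; apply: measurableI => //.
exact: (measurable_sample_preimage n (h @^-1` B)).
Qed.

Lemma measurable_next_fun n (D : set T) (K : seq int -> int -> \bar R) :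
  measurable_fun D (fun w => K (sample X n w) (X n w)).
Proof.
(* The sample of length [n + 1] determines both arguments of [K]. *)
have := @measurable_sample_fun n.+1 D (fun s => K (take n s) (last 0 s)).
apply: eq_measurable_fun => w _.
by rewrite sampleS last_rcons -cats1 take_size_cat// size_sample.
Qed.

Hypothesis indepX : mutually_independent X.

(** For [s] of length [n] the fibre is a finite intersection of events on single coordinates, so
    mutual independence applies to the first [n] indices and again with index [n] added. *)
Lemma sample_fiber_indep n (s : seq int) (A : set int) :
  Pr ([set w | sample X n w = s] `&` X n @^-1` A) =
  (Pr [set w | sample X n w = s] * Pr (X n @^-1` A))%E.
Proof.
have [sz|sz] := eqVneq (size s) n; last first.
  rewrite (_ : [set _ | _] = set0) ?set0I ?measure0 ?mul0e//.
  by apply/seteqP; split=> // w /= h; move: sz; rewrite -h size_sample eqxx.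
pose B i := if (i < n)%N then [set nth 0 s i] else A.
pose I k := [fset i in iota 0 k]%fset.
have fibE : [set w | sample X n w = s] =
    \bigcap_(i in [set` I n]) (X i @^-1` B i).
  apply/seteqP; split => w /=.
    move=> sE i /=; rewrite !inE/= mem_iota add0n /B => /= lin; rewrite lin /=.
    by rewrite -sE (nth_map 0%N) ?size_iota// nth_iota.
  move=> h; apply: (@eq_from_nth _ 0); first by rewrite size_sample.
  move=> i; rewrite size_sample => lin.
  have := h i; rewrite /= !inE/= mem_iota add0n /B lin => /(_ isT) /= h'.
  by rewrite -h' /sample (nth_map 0%N) ?size_iota// nth_iota.
have IS : I n.+1 = (n |` I n)%fset.
  by apply/fsetP => i; rewrite in_fset1U !in_fset !mem_iota !add0n ltnS (leq_eqVlt i).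
have fibSE : [set w | sample X n w = s] `&` X n @^-1` A =
    \bigcap_(i in [set` I n.+1]) (X i @^-1` B i).
  rewrite fibE IS; apply/seteqP; split => w /=.
    move=> [h An] i /=; rewrite in_fset1U => /orP[/eqP ->|]; last exact: h.
    by rewrite /B ltnn.
  move=> h; split; first by move=> i /= hi; apply: h; rewrite /= in_fset1U hi orbT.
  by have := h n; rewrite /B /= ltnn fsetU11; apply.
rewrite fibSE (indepX _) // fibE (indepX _)// IS big_fsetU1/=; last first.
  by rewrite !inE/= mem_iota add0n ltnn andbF.
by rewrite muleC {2}/B ltnn.
Qed.

Lemma integral_sample_value n (h : seq int -> \bar R) (A : set int) :
  (forall s, 0 <= h s)%E ->
  (\int[Pr]_(w in X n @^-1` A) h (sample X n w) =
   Pr (X n @^-1` A) * \int[Pr]_w h (sample X n w))%E.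
Proof.
move=> h0.
(* The codes cut the space into countably many pieces, each empty or a fibre on which the integrand
   is constant. *)
pose F k := [set w | choice.pickle (sample X n w) = k].
have mF k : measurable (F k).
  exact: (measurable_sample_preimage n [set s | choice.pickle s = k]).
have bF : \bigcup_k F k = setT.
  by apply/seteqP; split => // w _; exists (choice.pickle (sample X n w)).
have tF : trivIset setT F.
  apply/trivIsetP => i j _ _ ij; apply/seteqP; split => // w [Fi Fj].
  by move: ij; rewrite -Fi -Fj eqxx.
have mA := measurable_value_preimage n A.
have -> : (\int[Pr]_(w in X n @^-1` A) h (sample X n w) =
    \sum_(k <oo) \int[Pr]_(w in F k `&` X n @^-1` A) h (sample X n w))%E.
  rewrite -[in LHS](setTI (_ @^-1` _)) -bF setI_bigcupl ge0_integral_bigcup//.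
  - by move=> k; exact: measurableI.
  - exact: measurable_sample_fun.
  - exact: trivIset_setIr.
rewrite -bF ge0_integral_bigcup//; last exact: measurable_sample_fun.
have -> : (Pr (X n @^-1` A) = (fine (Pr (X n @^-1` A)))%:E)%E.
  by rewrite fineK// fin_num_measure.
rewrite -nneseriesZl; last by move=> k _; exact: integral_ge0.
apply: eq_eseriesr => k _; rewrite fineK ?fin_num_measure//.
have [[s sk]|nk] := pselect (exists s : seq int, choice.pickle s = k); last first.
  have -> : F k = set0.
    by apply/seteqP; split=> // w /= wk; apply: nk; exists (sample X n w).
  by rewrite set0I !integral_set0 mule0.
have FE : F k = [set w | sample X n w = s].
  apply/seteqP; split=> w; rewrite /F /mkset; last by move=> ->.
  by rewrite -sk => /(pcan_inj (@choice.pickleK _)).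
rewrite FE [LHS](eq_integral (cst (h s))); last first.
  by move=> w; rewrite inE => -[wE _]; rewrite wE.
rewrite [in RHS](eq_integral (cst (h s))); last by move=> w; rewrite inE /= => ->.
have mf := measurable_sample_fiber n s.
rewrite !integral_cst//; last exact: measurableI.
transitivity (h s * (Pr [set w | sample X n w = s] * Pr (X n @^-1` A)))%E.
  by congr (_ * _)%E; exact: sample_fiber_indep.
by rewrite muleA muleC.
Qed.

End samples.

(** * Optional stopping *)

Section supermartingales.
Context d (T : measurableType d) (R : realType) (Pr : probability T R).
Variable X : nat -> {RV Pr >-> int}.

(* If x is drawn next, the wealth h s loses l s when x = a and gains it when
   x = b.  The loss is stated as [K s a + l s = h s]: without subtraction, no
   integral has to be finite. *)
Lemma integral_next_le n (K : seq int -> int -> \bar R)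
    (h l : seq int -> \bar R) (a b : int) :
  mutually_independent X -> a != b ->
  (Pr (X n @^-1` [set b]) <= Pr (X n @^-1` [set a]))%E ->
  (forall s x, 0 <= K s x)%E -> (forall s, 0 <= h s)%E ->
  (forall s, 0 <= l s)%E ->
  (forall s x, x != a -> x != b -> K s x = h s) ->
  (forall s, K s b = h s + l s)%E -> (forall s, K s a + l s = h s)%E ->
  (\int[Pr]_w K (sample X n w) (X n w) <= \int[Pr]_w h (sample X n w))%E.
Proof.
move=> indepX ab leba K0 h0 l0 Kh Kb Ka.
pose A := X n @^-1` [set a]; pose B := X n @^-1` [set b].
pose C := X n @^-1` (~` [set a; b]).
have [mA mB mC] : [/\ measurable A, measurable B & measurable C].
  by split; exact: measurable_value_preimage.
have dBC : [disjoint B & C].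
  by apply/disj_set2P/seteqP; split=> // w [Xb]; apply; right.
have dABC : [disjoint A & B `|` C].
  apply/disj_set2P/seteqP; split=> // w [Xa [Xb|]]; last by apply; left.
  by move: ab; rewrite -[a]Xa -[b]Xb eqxx.
have TE : setT = A `|` (B `|` C).
  apply/seteqP; split=> // w _.
  have [?|Xa] := eqVneq (X n w) a; first by left.
  have [?|Xb] := eqVneq (X n w) b; first by right; left.
  by right; right=> /= -[/eqP|/eqP]; rewrite ?(negbTE Xa) ?(negbTE Xb).
have split_integral (f : T -> \bar R) : measurable_fun setT f ->
    (forall w, 0 <= f w)%E ->
    (\int[Pr]_w f w = \int[Pr]_(w in A) f w +
      (\int[Pr]_(w in B) f w + \int[Pr]_(w in C) f w))%E.
  move=> mf f0; rewrite TE ge0_integral_setU//; last 2 first.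
  - exact: measurableU.
  - by rewrite -TE.
  rewrite ge0_integral_setU//.
  exact: measurable_funS mf.
rewrite split_integral//; last exact: measurable_next_fun.
rewrite [leRHS]split_integral//; last exact: measurable_sample_fun.
have -> : (\int[Pr]_(w in C) K (sample X n w) (X n w) =
           \int[Pr]_(w in C) h (sample X n w))%E.
  apply: eq_integral => w; rewrite inE => /= /not_orP[Xa Xb].
  by apply: Kh; exact/eqP.
have -> : (\int[Pr]_(w in B) K (sample X n w) (X n w) =
           \int[Pr]_(w in B) h (sample X n w) +
           \int[Pr]_(w in B) l (sample X n w))%E.
  rewrite -ge0_integralD//; [|exact: measurable_sample_fun..].
  by apply: eq_integral => w; rewrite inE => /= ->.
have -> : (\int[Pr]_(w in A) h (sample X n w) =
           \int[Pr]_(w in A) K (sample X n w) (X n w) +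
           \int[Pr]_(w in A) l (sample X n w))%E.
  rewrite -ge0_integralD//; first last.
  - exact: measurable_sample_fun.
  - exact: measurable_next_fun.
  by apply: eq_integral => w; rewrite inE => /= ->.
have shuffle (x y z : \bar R) : (x + y + z = y + (x + z))%E.
  by rewrite (addeC x) addeA.
(* After cancellation the integral of [l] over [B] must be at most the one over [A]. By independence
   each is a probability times the same mean of [l], and [leba] compares the probabilities. *)
rewrite -[leRHS]addeA leeD2l// shuffle leeD2r// !integral_sample_value//.
by rewrite lee_wpmul2r// integral_ge0.
Qed.

(** Preimages of arbitrary sets under [sample X n] already form a sigma-algebra, and it contains the
    generators. *)
Lemma natural_filtration_sample n (U : set T) :
  natural_filtration X n U -> exists S, U = sample X n @^-1` S.
Proof.
have sigG : sigma_algebra setT (preimage_set_system setT (sample X n) setT).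
  by apply: sigma_algebra_preimage; split.
move=> /(smallest_sub sigG) h.
suff /h[S _ <-] : \bigcup_(i in [set i | (i < n)%N])
    preimage_set_system setT (X i) measurable `<=`
    preimage_set_system setT (sample X n) setT.
  by exists S; rewrite setTI.
move=> _ [i /= lin] [A _ <-]; exists [set s | A (nth 0 s i)] => //.
by rewrite !setTI; apply/seteqP; split=> w /=;
  rewrite /sample (nth_map 0%N) ?size_iota// nth_iota.
Qed.

(* The minimum over Theta need not be a supermartingale itself, hence the
   separate dominating process N. *)
Lemma optional_stopping_le (M N : seq int -> \bar R) (tau : T -> option nat) :
  (forall s, 0 <= M s)%E -> (forall s, M s <= N s)%E ->
  (forall n S, (\int[Pr]_(w in sample X n @^-1` S) N (sample X n.+1 w) <=
                \int[Pr]_(w in sample X n @^-1` S) N (sample X n w))%E) ->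
  stopping_time X tau ->
  (\int[Pr]_w stopped M X tau w <= N [::])%E.
Proof.
move=> M0 MN superN tauX.
have N0 s : (0 <= N s)%E by exact: le_trans (MN s).
(* With the strict inequality, the complement of [U n.+1] is the event that [tau] exceeds [n], which
   the first [n] observations decide. *)
pose U n := [set w | exists2 k, tau w = Some k & (k < n)%N].
have US n : exists S, ~` U n.+1 = sample X n @^-1` S.
  have /natural_filtration_sample[S SE] := tauX n.
  by exists (~` S); rewrite -preimage_setC -SE.
have mU n : measurable (~` U n).
  case: n => [|n].
    rewrite (_ : ~` _ = setT)//; apply/seteqP; split=> // w _ [k _].
    by rewrite ltn0.
  by have [S ->] := US n; exact: measurable_sample_preimage.
pose E n := [set w | tau w = Some n].
have EU n : ~` U n = E n `|` ~` U n.+1.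
  apply/seteqP; split=> w /=.
    move=> nUw; have [?|En] := pselect (E n w); [by left|right].
    move=> -[k tk]; rewrite ltnS leq_eqVlt => /orP[/eqP kn|kn].
      by apply: En; rewrite /E /= tk kn.
    by apply: nUw; exists k.
  move=> [En [k]|nU [k tk kn]]; first by rewrite En => -[->]; rewrite ltnn.
  by apply: nU; exists k => //; exact: ltnW.
have dEU n : [disjoint E n & ~` U n.+1].
  by apply/disj_set2P/seteqP; split=> // w [/= En]; apply; exists n.
have mE n : measurable (E n).
  rewrite (_ : E n = ~` U n `\` ~` U n.+1); first exact: measurableD.
  rewrite EU setDUl setDv setU0; apply/esym/setDidPl/disj_set2P.
  exact: dEU.
(* The left side is the mean of [N] at the earlier of [tau] and [n]. By [EU] the running part either
   stops at [n] or goes on, and [superN] handles the latter. *)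
have bound n : (\sum_(0 <= k < n) \int[Pr]_(w in E k) N (sample X k w) +
    \int[Pr]_(w in ~` U n) N (sample X n w) <= N [::])%E.
  elim: n => [|n IH].
    rewrite big_geq// add0e (_ : ~` _ = setT).
      rewrite (eq_integral (cst (N [::])))// integral_cst//.
      rewrite -[leRHS]mule1 lee_wpmul2l//; exact: probability_le1.
    by apply/seteqP; split=> // w _ [k _]; rewrite ltn0.
  apply: le_trans IH; rewrite big_nat_recr//= -addeA leeD2l//.
  rewrite [in leRHS]EU ge0_integral_setU//; last exact: measurable_sample_fun.
  by rewrite leeD2l//; have [S ->] := US n.
(* The events [E k] are disjoint, so at most one term of the series is nonzero. *)
have -> : stopped M X tau =
    fun w => (\sum_(k <oo) ((fun w => M (sample X k w)) \_ (E k)) w)%E.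
  apply/funext => w; rewrite /stopped.
  case tw : (tau w) => [n|]; last first.
    rewrite eseries0// => k _ _; rewrite patchN//.
    by apply/negP; rewrite inE /E /= tw.
  rewrite (nneseriesD1 (n := n))//; last first.
    by move=> k _; rewrite /patch; case: ifP.
  rewrite eseries0 ?adde0 ?patchT ?inE//= => k _ /= kn.
  rewrite patchN//; apply/negP; rewrite inE /E /= tw => -[nk].
  by rewrite nk eqxx in kn.
rewrite integral_nneseries//; last 2 first.
- move=> k; apply/(measurable_restrictT _ _).1 => //.
  exact: measurable_sample_fun.
- by move=> k w _; rewrite /patch; case: ifP.
apply: lime_le.
  by apply: is_cvg_nneseries => k _ _; apply: integral_ge0 => w _;
     rewrite /patch; case: ifP.
apply: nearW => n; apply: le_trans (bound n).
under eq_bigr do rewrite -integral_mkcond.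
apply: (@le_trans _ _ (\sum_(0 <= k < n) \int[Pr]_(w in E k) N (sample X k w))%E).
  by apply: lee_sum => k _; apply: ge0_le_integral => //;
     exact: measurable_sample_fun.
by rewrite leeDl// integral_ge0.
Qed.

End supermartingales.

(** * The betting wealth *)

Section wealth.
Context (R : realType).
Implicit Types (y s : seq int) (m : nat).

Lemma mass_ge0 (mu : {measure set int -> \bar R}) n : 0 <= mass mu n.
Proof. exact: fine_ge0. Qed.

Lemma bet_lambda_bounds (mu : {measure set int -> \bar R}) m :
  0 <= bet_lambda mu m <= 2^-1.
Proof.
rewrite /bet_lambda; set a := mass mu _; set b := mass mu _.
have a0 : 0 <= a by exact: mass_ge0.
have b0 : 0 <= b by exact: mass_ge0.
have [ab0|] := ltP 0 (b + a); last first.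
  (* Both masses vanish, and the quotient is 0 because [0^-1 = 0]. *)
  move=> ab0; have -> : a = 0 by lra.
  have -> : b = 0 by lra.
  by rewrite addr0 mulr0 invr0 mulr0 lexx invr_ge0 ler0n.
rewrite divr_ge0 ?le_max ?lexx ?orbT// ?mulr_ge0 ?addr_ge0//=.
rewrite ler_pdivrMr ?mulr_gt0// mulKf ?pnatr_eq0// ge_max.
by rewrite addr_ge0// andbT; lra.
Qed.

(** Stake 0 on the empty sample brings the special case of [empirical_bet] under the general
    formula. *)
Definition stake m y : R := if y is [::] then 0 else bet_lambda (empirical R y) m.

Lemma stake_bounds m y : 0 <= stake m y <= 2^-1.
Proof.
case: y => [|x y]; first by rewrite lexx invr_ge0 ler0n.
exact: bet_lambda_bounds.
Qed.

Lemma empirical_betE m y x :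
  empirical_bet R y m x =
  1 + stake m y * (- (x == m%:Z)%:R + (x == m%:Z + 1)%:R).
Proof. by case: y => //; rewrite /= mul0r addr0. Qed.

Lemma empirical_bet_ge0 m y x : 0 <= empirical_bet R y m x.
Proof.
rewrite empirical_betE; have /andP[l0 l1] := stake_bounds m y.
by case: (x == _); case: (x == _) => /=; lra.
Qed.

Lemma wealth_rcons m y x :
  wealth R m (rcons y x) = wealth R m y * empirical_bet R y m x.
Proof.
rewrite /wealth size_rcons big_ord_recr/= nth_rcons ltnn eqxx.
rewrite -cats1 take_size_cat//; congr (_ * _); apply: eq_bigr => k _.
by rewrite takel_cat 1?ltnW// nth_cat ltn_ord.
Qed.

Lemma wealth_ge0 m y : 0 <= wealth R m y.
Proof. by apply: prodr_ge0 => k _; exact: empirical_bet_ge0. Qed.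

Lemma J_ge0 theta s : (0 <= J R theta s)%E.
Proof.
by apply: nneseries_ge0 => m _ _; rewrite lee_fin mulr_ge0 ?addr_ge0 ?wealth_ge0//.
Qed.

Lemma J_nil theta : J R theta [::] = 1%E.
Proof.
(* Both wealths start at 1, so the term of index [m] is [2 ^- (m + 1)]. *)
have /cvg_lim := @cvg_geometric_eseries_half R 1 0.
rewrite expr0 divr1 => <- //; congr (limn _); apply/funext => n; apply: eq_bigr => m _.
rewrite /J_plus /J_minus /wealth !big_ord0 addn1 natrX -exprVn addn2 exprS.
rewrite exprVn; congr (_%:E).
by rewrite exprS invfM mulrAC -[1 + 1]/(2%:R) mulVf ?mul1r ?pnatr_eq0.
Qed.

End wealth.

(** * Supermartingale property under a unimodal law *)

Section supermartingale.
Context d (T : measurableType d) (R : realType) (Pr : probability T R).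
Variable X : nat -> {RV Pr >-> int}.

(** The bet moves money from [a] to the no more likely [b]. The map [f] will be the shift or the
    reflection at the mode, and [S] will describe the event of not having stopped yet. *)
Lemma wealth_supermartingale (f : int -> int) (a b : int) m n
    (S : set (seq int)) :
  mutually_independent X -> injective f -> f a = m%:Z -> f b = m%:Z + 1 ->
  (Pr (X n @^-1` [set b]) <= Pr (X n @^-1` [set a]))%E ->
  (\int[Pr]_(w in sample X n @^-1` S) (wealth R m (map f (sample X n.+1 w)))%:E <=
   \int[Pr]_(w in sample X n @^-1` S) (wealth R m (map f (sample X n w)))%:E)%E.
Proof.
move=> indepX injf fa fb leba.
(* Cutting off outside [S] gives integrals over the whole space, the form that [integral_next_le]
   takes. *)
pose on_S (g : seq int -> \bar R) s : \bar R := if s \in S then g s else 0%E.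
have toS (g : seq int -> T -> \bar R) :
    (\int[Pr]_(w in sample X n @^-1` S) g (sample X n w) w =
     \int[Pr]_w on_S (g ^~ w) (sample X n w))%E.
  by rewrite integral_mkcond; apply: eq_integral.
have on_S_ge0 g s : (0 <= g s)%E -> (0 <= on_S g s)%E.
  by rewrite /on_S; case: ifP.
pose W y : R := wealth R m (map f y).
pose L y : R := W y * stake R m (map f y).
have W0 y : 0 <= W y by exact: wealth_ge0.
have L0 y : 0 <= L y.
  by rewrite mulr_ge0//; case/andP: (stake_bounds R m (map f y)).
pose K s x := on_S (fun s => (W (rcons s x))%:E) s.
under eq_integral do rewrite sampleS.
rewrite (toS (fun s w => (W (rcons s (X n w)))%:E)) (toS (fun s w => (W s)%:E)).
have WE y x : W (rcons y x) =
    W y + L y * (- (f x == m%:Z)%:R + (f x == m%:Z + 1)%:R).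
  by rewrite /W map_rcons wealth_rcons empirical_betE mulrDr mulr1 mulrA.
have m1 : (m%:Z == m%:Z + 1) = false by apply/negbTE; lia.
apply: (@integral_next_le _ _ _ _ X n K _ (on_S (fun s => (L s)%:E)) a b) => //.
- by apply/eqP => ab; move: m1; rewrite -fb -fa ab eqxx.
- by move=> s x; apply: on_S_ge0; rewrite lee_fin.
- by move=> s; apply: on_S_ge0; rewrite lee_fin.
- by move=> s; apply: on_S_ge0; rewrite lee_fin.
- move=> s x xa xb; rewrite /K /on_S WE -fb -fa !(inj_eq injf).
  by rewrite (negbTE xa) (negbTE xb) oppr0 addr0 mulr0 addr0.
- move=> s; rewrite /K /on_S WE fb eqxx eq_sym m1 oppr0 add0r mulr1.
  by case: ifP => // _; rewrite adde0.
- move=> s; rewrite /K /on_S WE fa eqxx m1 addr0 mulrN1.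
  by case: ifP => // _; rewrite ?adde0// -EFinD subrK.
Qed.

Lemma J_supermartingale (P : probability int R) theta n S :
  iid X P -> unimodal theta P ->
  (\int[Pr]_(w in sample X n @^-1` S) J R theta (sample X n.+1 w) <=
   \int[Pr]_(w in sample X n @^-1` S) J R theta (sample X n w))%E.
Proof.
move=> [indepX distX] [incP decP].
have PrE x : Pr (X n @^-1` [set x]) = (mass P x)%:E.
  transitivity (P [set x]); first exact: distX.
  by rewrite /mass fineK// fin_num_measure.
have mS : measurable (sample X n @^-1` S) by exact: measurable_sample_preimage.
have c0 m : 0 <= 2 ^- (m + 2) :> R by rewrite invr_ge0 exprn_ge0.
have t0 m s : (0 <= (2 ^- (m + 2) * (J_plus R theta m s + J_minus R theta m s))%:E)%E.
  by rewrite lee_fin mulr_ge0// addr_ge0// wealth_ge0.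
have mfun k (g : seq int -> R) :
    measurable_fun (sample X n @^-1` S) (fun w => (g (sample X k w))%:E).
  exact: (@measurable_sample_fun _ _ _ _ X k _ (fun s => (g s)%:E)).
pose term m s := 2 ^- (m + 2) * (J_plus R theta m s + J_minus R theta m s).
rewrite /J !integral_nneseries//; try by move=> m; exact: (mfun _ (term m)).
apply: lee_nneseries => [m _ _|m _]; first by apply: integral_ge0 => w _.
under eq_integral do rewrite EFinM.
under [leRHS]eq_integral do rewrite EFinM.
pose V s := J_plus R theta m s + J_minus R theta m s.
have V0 k w :
    (0 <= (J_plus R theta m (sample X k w) + J_minus R theta m (sample X k w))%:E)%E.
  by rewrite lee_fin addr_ge0// wealth_ge0.
rewrite !ge0_integralZl_EFin//; try exact: (mfun _ V).
rewrite lee_pmul2l// ?lte_fin ?invr_gt0 ?exprn_gt0//.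
under eq_integral do rewrite EFinD.
under [leRHS]eq_integral do rewrite EFinD.
rewrite !ge0_integralD//;
  try by [exact: (mfun _ (J_plus R theta m))|exact: (mfun _ (J_minus R theta m))
         |move=> w _; rewrite lee_fin wealth_ge0].
(* Both sides bet away from the mode: from [theta + m] to [theta + m + 1], and from [theta - m] to
   [theta - m - 1]. *)
apply: leeD.
  apply: (@wealth_supermartingale _ (theta + m%:Z) (theta + m%:Z + 1)) => //.
  - exact: addIr.
  - by lia.
  - by lia.
  - by rewrite !PrE lee_fin decP// lerDl.
apply: (@wealth_supermartingale _ (theta - m%:Z) (theta - m%:Z - 1)) => //.
- by move=> x y /addrI /oppr_inj.
- by lia.
- by lia.
- by rewrite !PrE lee_fin incP// lerBlDr lerDl.
Qed.

End supermartingale.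

(** * Strong law for frequencies *)

(** Since [expR (- y) >= 1 - y], it is enough that [(1 + y + 2 * y ^+ 2) * (1 - y) = 1 + y ^+ 2 * (1
    - 2 * y)] is at least 1. *)
Lemma expR_le_quadratic (R : realType) (y : R) :
  y <= 2^-1 -> expR y <= 1 + y + 2 * y ^+ 2.
Proof.
move=> y2; have e0 : 0 < expR (- y) by exact: expR_gt0.
have ey : expR y = (expR (- y))^-1 by rewrite expRN invrK.
rewrite ey -[leLHS]mul1r ler_pdivrMr//.
have := expR_ge1Dx (- y) => e1.
apply: (@le_trans _ _ ((1 + y + 2 * y ^+ 2) * (1 - y))).
  by nra.
by rewrite ler_wpM2l//; nra.
Qed.

(** The left side is the exponential moment of [c] times a Bernoulli variable centred at [q]. The
    centred values are at most 2 in size, so the quadratic error is at most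
    [2 * (2 * c) ^+ 2 = 8 * c ^+ 2]. *)
Lemma bernoulli_exp_moment_lt1 (R : realType) (p q c : R) :
  0 <= p <= 1 -> -1 <= q <= 2 -> `|c| <= 4^-1 -> c * (p - q) + 8 * c ^+ 2 < 0 ->
  p * expR (c * (1 - q)) + (1 - p) * expR (c * (0 - q)) < 1.
Proof.
move=> /andP[p0 p1] /andP[q0 q1] hc; have := hc; rewrite ler_norml => /andP[c0 c1].
move=> drift.
have small z : -2 <= z <= 2 -> c * z <= 2^-1.
  move=> /andP[z0 z1]; apply: le_trans (ler_norm _) _; rewrite normrM.
  have : `|z| <= 2 by rewrite ler_norml; apply/andP.
  by have := normr_ge0 c; have := normr_ge0 z; nra.
have e1 : expR (c * (1 - q)) <= 1 + c * (1 - q) + 8 * c ^+ 2.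
  apply: le_trans (expR_le_quadratic _) _; first by apply: small; lra.
  rewrite lerD2l exprMn.
  have : (1 - q) ^+ 2 <= 4 by nra.
  by have := sqr_ge0 c; nra.
have e2 : expR (c * (0 - q)) <= 1 + c * (0 - q) + 8 * c ^+ 2.
  apply: le_trans (expR_le_quadratic _) _; first by apply: small; lra.
  rewrite lerD2l exprMn.
  have : (0 - q) ^+ 2 <= 4 by nra.
  by have := sqr_ge0 c; nra.
have p1' : 0 <= 1 - p by lra.
have := ler_wpM2l p0 e1; have := ler_wpM2l p1' e2; lra.
Qed.

Section frequencies.
Context d (T : measurableType d) (R : realType) (Pr : probability T R).
Variables (X : nat -> {RV Pr >-> int}) (P : probability int R).
Hypothesis iidX : iid X P.

Lemma mass_le1 n : mass P n <= 1.
Proof. by rewrite -lee_fin fineK ?fin_num_measure// probability_le1. Qed.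

Lemma integral_prod_sample (j : int) (u v : R) n : 0 <= u -> 0 <= v ->
  (\int[Pr]_w (\prod_(x <- sample X n w) (if x == j then u else v))%:E =
   ((mass P j * u + (1 - mass P j) * v) ^+ n)%:E)%E.
Proof.
move=> u0 v0; have [indepX distX] := iidX.
pose D s : R := \prod_(x <- s) (if x == j then u else v).
have D0 s : 0 <= D s by apply: prodr_ge0 => x _; case: ifP.
have DS s x : D (rcons s x) = D s * (if x == j then u else v).
  by rewrite /D -cats1 big_cat big_seq1.
elim: n => [|n IH].
  rewrite (eq_integral (cst 1%E)); last by move=> w _; rewrite big_nil.
  rewrite integral_cst// mul1e expr0; exact: probability_setT.
pose A := X n @^-1` [set j].
have mA : measurable A by exact: measurable_value_preimage.
have mD k (r : R) B : measurable_fun B (fun w => (r * D (sample X k w))%:E).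
  exact: (@measurable_sample_fun _ _ _ _ X k _ (fun s => (r * D s)%:E)).
have intA (B : set int) (r : R) : 0 <= r ->
    (\int[Pr]_(w in X n @^-1` B) (r * D (sample X n w))%:E =
     P B * (r%:E * \int[Pr]_w (D (sample X n w))%:E))%E.
  move=> r0.
  rewrite (@integral_sample_value _ _ _ _ X indepX n (fun s => (r * D s)%:E))//; last first.
    by move=> s; rewrite lee_fin mulr_ge0.
  congr (_ * _)%E; first exact: distX.
  under eq_integral do rewrite EFinM.
  rewrite ge0_integralZl_EFin// => [w _|]; first by rewrite lee_fin.
  by have := mD n 1 setT; under eq_fun do rewrite mul1r.
have -> : (\int[Pr]_w (D (sample X n.+1 w))%:E =
    \int[Pr]_(w in A) (u * D (sample X n w))%:E +
    \int[Pr]_(w in ~` A) (v * D (sample X n w))%:E)%E.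
  rewrite -(setUv A) ge0_integral_setU//; first last.
  - exact/disj_set2P/setICr.
  - by move=> w _; rewrite lee_fin.
  - by have := mD n.+1 1 (A `|` ~` A); under eq_fun do rewrite mul1r.
  - exact: measurableC.
  congr (_ + _)%E; apply: eq_integral => w; rewrite inE sampleS DS mulrC.
    by rewrite /A /= => ->; rewrite eqxx.
  by move=> /eqP/negbTE ->.
rewrite intA// (intA (~` [set j]))// {}IH.
have Pj : P [set j] = (mass P j)%:E by rewrite fineK// fin_num_measure.
have -> : P (~` [set j]) = (1 - mass P j)%:E.
  by rewrite probability_setC// Pj.
by rewrite Pj -!EFinM -EFinD exprS !mulrA -mulrDl.
Qed.

(** The means [r ^+ n] are summable, so the series of products is almost surely finite and its terms
    tend to 0. *)
Lemma ae_prod_sample_lt1 (j : int) (u v : R) : 0 <= u -> 0 <= v ->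
  mass P j * u + (1 - mass P j) * v < 1 ->
  {ae Pr, forall w, \forall n \near \oo,
    \prod_(x <- sample X n w) (if x == j then u else v) < 1}.
Proof.
move=> u0 v0; set r := _ + _ => r1.
have r0 : 0 <= r by rewrite addr_ge0// mulr_ge0 ?subr_ge0 ?mass_le1 ?mass_ge0.
pose D n w := \prod_(x <- sample X n w) (if x == j then u else v).
have D0 n w : 0 <= D n w by apply: prodr_ge0 => x _; case: ifP.
have mD n : measurable_fun setT (fun w => (D n w)%:E).
  exact: (@measurable_sample_fun _ _ _ _ X n _
    (fun s => (\prod_(x <- s) (if x == j then u else v))%:E)).
pose S w := (\sum_(n <oo) (D n w)%:E)%E.
have S0 w : (0 <= S w)%E by apply: nneseries_ge0 => n _ _; rewrite lee_fin.
have mS : measurable_fun setT S.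
  by apply: ge0_emeasurable_sum => // n w _ _; rewrite lee_fin.
have intS : (\int[Pr]_w S w < +oo)%E.
  rewrite integral_nneseries//; last by move=> n w _; rewrite lee_fin.
  under eq_eseriesr do rewrite integral_prod_sample//.
  apply: (@le_lt_trans _ _ ((1 - r)^-1)%:E); last by rewrite ltry.
  apply: lime_le.
    by apply: is_cvg_nneseries => n _ _; rewrite lee_fin exprn_ge0.
  apply: nearW => n; rewrite sumEFin lee_fin.
  have := geometric_seriesE (1 : R) (z := r).
  rewrite lt_eqF// => /(_ isT) /(congr1 (@^~ n)) /=.
  rewrite /series/= => h; rewrite (eq_bigr (geometric 1 r)); last first.
    by move=> k _; rewrite /= mul1r.
  rewrite h mul1r ler_pdivrMr ?subr_gt0// mulVf ?subr_eq0 ?gt_eqF//.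
  by rewrite gerBl exprn_ge0.
have integS : Pr.-integrable setT S.
  apply/integrableP; split => //.
  by under eq_integral do rewrite gee0_abs//.
have := integrable_ae measurableT integS.
apply: filterS => w /(_ I) Sfin.
have /nnseries_is_cvg : (\sum_(n <oo) (D n w)%:E < +oo)%E.
  by rewrite ltey_eq Sfin.
move=> /(_ (fun n => D0 n w)) /cvg_series_cvg_0 /cvgr_lt; exact.
Qed.

(** With these [u] and [v] the product is the exponential of the displayed quantity. The sign of [c]
    selects the upper or the lower tail. *)
Lemma ae_count_drift (j : int) (c q : R) :
  -1 <= q <= 2 -> `|c| <= 4^-1 -> c * (mass P j - q) + 8 * c ^+ 2 < 0 ->
  {ae Pr, forall w, \forall n \near \oo,
    c * ((count_mem j (sample X n w))%:R - n%:R * q) < 0}.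
Proof.
move=> hq hc drift.
have := @ae_prod_sample_lt1 j (expR (c * (1 - q))) (expR (c * (0 - q))).
move=> /(_ (expR_ge0 _) (expR_ge0 _)).
move=> /(_ (bernoulli_exp_moment_lt1 _ hq hc drift)).
rewrite mass_ge0 mass_le1 => /(_ isT).
apply: filterS => w; apply: filterS => n.
have prodE s : \prod_(x <- s)
    (if x == j then expR (c * (1 - q)) else expR (c * (0 - q))) =
    expR (c * ((count_mem j s)%:R - (size s)%:R * q)).
  elim: s => [|x s IH]; first by rewrite big_nil mul0r subr0 mulr0 expR0.
  rewrite big_cons IH /= natrD -(natr1 (size s)).
  by case: (x == j); rewrite -expRD; congr expR; rewrite /=; ring.
by rewrite prodE size_sample -expR0 ltr_expR.
Qed.

Lemma frequency_cvg (j : int) :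
  {ae Pr, forall w,
    (count_mem j (sample X n w))%:R / n%:R @[n --> \oo] --> mass P j}.
Proof.
set p := mass P j.
have [p0 p1] : 0 <= p /\ p <= 1 by rewrite mass_ge0 mass_le1.
(* Countably many tolerances suffice, so the exceptional sets can be merged into one; [eps k <= 1]
   keeps [q] in the range from -1 to 2. *)
pose eps (k : nat) : R := k.+1%:R^-1.
have eps0 k : 0 < eps k by rewrite invr_gt0 ltr0n.
have eps1 k : eps k <= 1 by rewrite invf_le1 ?ler1n ?ltr0n.
have upper k : {ae Pr, forall w, \forall n \near \oo,
    (count_mem j (sample X n w))%:R < n%:R * (p + eps k)}.
  have := eps0 k; have := eps1 k => e1 e0.
  (* With [c = eps k / 16] the drift is [- eps k ^+ 2 / 16] and the error half of that,
     [eps k ^+ 2 / 32]. *)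
  have := @ae_count_drift j (eps k / 16) (p + eps k).
  have -> : -1 <= p + eps k <= 2 by apply/andP; lra.
  have -> : `|eps k / 16| <= 4^-1 by rewrite ger0_norm; lra.
  move=> /(_ isT isT) H.
  have /H : eps k / 16 * (mass P j - (p + eps k)) + 8 * (eps k / 16) ^+ 2 < 0.
    by rewrite -/p; nra.
  apply: filterS => w; apply: filterS => n.
  by rewrite pmulr_rlt0 ?subr_lt0// divr_gt0.
have lower k : {ae Pr, forall w, \forall n \near \oo,
    n%:R * (p - eps k) < (count_mem j (sample X n w))%:R}.
  have := eps0 k; have := eps1 k => e1 e0.
  have := @ae_count_drift j (- (eps k / 16)) (p - eps k).
  have -> : -1 <= p - eps k <= 2 by apply/andP; lra.
  have -> : `|- (eps k / 16)| <= 4^-1 by rewrite normrN ger0_norm; lra.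
  move=> /(_ isT isT) H.
  have /H : - (eps k / 16) * (mass P j - (p - eps k)) + 8 * (- (eps k / 16)) ^+ 2 < 0.
    by rewrite -/p; nra.
  apply: filterS => w; apply: filterS => n.
  by rewrite mulNr oppr_lt0 pmulr_rgt0 ?subr_gt0// divr_gt0.
have /ae_foralln up := upper; have /ae_foralln low := lower.
apply: filterS2 up low => w up low; apply/cvgrPdist_lt => e e_gt0.
have [k keps] : exists k, eps k < e.
  exists (Num.truncn e^-1); rewrite /eps -[ltRHS]invrK ltf_pV2 ?posrE ?invr_gt0//.
  exact: truncnS_gt.
have {}up := up k; have {}low := low k.
near=> n.
have n0 : 0 < n%:R :> R by rewrite ltr0n; near: n; exact: nbhs_infty_gt.
apply: le_lt_trans keps; rewrite distrC ler_distl.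
rewrite ler_pdivlMr// ler_pdivrMr// !(mulrC _ n%:R); apply/andP; split; apply/ltW.
  by near: n.
by near: n.
Unshelve. all: by end_near. Qed.

End frequencies.

(** * Exponential growth *)

Section growth.
Context (R : realType).

Lemma mass_empirical (y : seq int) (j : int) :
  mass (empirical R y) j = (count_mem j y)%:R / (size y)%:R.
Proof.
rewrite /mass /empirical /= /mscale /= /msum /=.
under eq_bigr do rewrite diracE.
rewrite sumEFin -EFinM /= mulrC; congr (_ / _).
rewrite -natr_sum; congr (_%:R).
rewrite -sum1_count (big_nth 0) big_mkord [RHS]big_mkcond.
apply: eq_bigr => i _ /=; case: eqP => [->|ne]; first by rewrite mem_set.
by rewrite memNset.
Qed.

(** Halving the rate absorbs a constant factor, such as the weight of a term in the mixture. *)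
Lemma expR_dominates (C delta : R) : 0 < C -> 0 < delta ->
  \forall n \near \oo, expR (delta / 2 * n%:R) <= C * expR (delta * n%:R).
Proof.
move=> C0 delta0; near=> n.
rewrite -{1}(lnK C0) -expRD ler_expR.
have : - ln C / (delta / 2) <= n%:R by near: n; exact: nbhs_infty_ger.
rewrite ler_pdivrMr ?divr_gt0//; lra.
Unshelve. all: by end_near. Qed.

(** Over the common denominator the numerator is [l * (b - a - l * (a + b))]. Half the Kelly stake
    leaves [(b - a) / 2] in the bracket, whereas the full stake would leave 0. *)
Lemma half_kelly_growth_gt0 (a b l : R) : 0 <= a -> a < b ->
  l * (a + b) = (b - a) / 2 -> 0 < b * (l / (1 + l)) - a * (l / (1 - l)).
Proof.
move=> a0 ab lab.
have l0 : 0 < l by nra.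
have l1 : l < 1 by nra.
have -> : b * (l / (1 + l)) - a * (l / (1 - l)) =
    l * ((b - a) / 2) / ((1 + l) * (1 - l)).
  have -> : (b - a) / 2 = b - a - l * (a + b) by lra.
  by field; apply/andP; split; rewrite gt_eqF; lra.
by rewrite divr_gt0 ?mulr_gt0//; lra.
Qed.

Lemma expR_le_1D (l : R) : 0 <= l -> expR (l / (1 + l)) <= 1 + l.
Proof.
move=> l0; have := expR_ge1Dx (- (l / (1 + l))).
have -> : 1 - l / (1 + l) = (1 + l)^-1 by field; rewrite gt_eqF; lra.
by rewrite expRN lef_pV2 ?posrE ?expR_gt0//; lra.
Qed.

Lemma expR_le_1B (l : R) : l < 1 -> expR (- (l / (1 - l))) <= 1 - l.
Proof.
move=> l1; have := expR_ge1Dx (l / (1 - l)).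
have -> : 1 + l / (1 - l) = (1 - l)^-1 by field; rewrite gt_eqF; lra.
by rewrite -lef_pV2 ?posrE ?expR_gt0 ?invr_gt0 ?subr_gt0// invrK expRN.
Qed.

Lemma wealth_gt0 m y : 0 < wealth R m y.
Proof.
apply: prodr_gt0 => k _; rewrite empirical_betE.
have /andP[l0 l1] := stake_bounds R m (take k y).
by case: (_ == _); case: (_ == _) => /=; lra.
Qed.

Lemma stake_cvg (x : nat -> int) m (a b : R) : 0 <= a -> a < b ->
  (count_mem m%:Z (mkseq x n))%:R / n%:R @[n --> \oo] --> a ->
  (count_mem (m%:Z + 1) (mkseq x n))%:R / n%:R @[n --> \oo] --> b ->
  stake R m (mkseq x n) @[n --> \oo] --> (b - a) / (2 * (a + b)).
Proof.
move=> a0 ab; set fa := fun n => _ / _; set fb := fun n => _ / _ => cva cvb.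
have : (fb n - fa n) / (2 * (fa n + fb n)) @[n --> \oo] --> (b - a) / (2 * (a + b)).
  apply: cvgM; first exact: cvgB.
  apply: cvgV; first by rewrite mulf_neq0 ?pnatr_eq0// gt_eqF; lra.
  by apply: cvgMr; exact: cvgD.
apply: cvg_trans; apply: near_eq_cvg; near=> n.
have n0 : (0 < n)%N by near: n; exact: nbhs_infty_gt.
(* The limits are strictly ordered, so eventually the positive part in the stake has no effect. *)
have fab : fa n < fb n.
  rewrite -subr_gt0; near: n; apply: (cvgr_gt (b - a)); last by rewrite subr_gt0.
  exact: cvgB.
rewrite /stake; case E : (mkseq x n) => [|z s].
  by move: n0; rewrite -(size_mkseq x n) E.
rewrite -E /bet_lambda !mass_empirical size_mkseq -/(fa n) -/(fb n).
by rewrite max_l// subr_ge0 ltW.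
Unshelve. all: by end_near. Qed.

Lemma wealth_growth (x : nat -> int) m (a b : R) : 0 <= a -> a < b ->
  (count_mem m%:Z (mkseq x n))%:R / n%:R @[n --> \oo] --> a ->
  (count_mem (m%:Z + 1) (mkseq x n))%:R / n%:R @[n --> \oo] --> b ->
  exists2 delta : R, 0 < delta &
    \forall n \near \oo, expR (delta * n%:R) <= wealth R m (mkseq x n).
Proof.
move=> a0 ab cva cvb; have cvl := stake_cvg a0 ab cva cvb.
move: cvl; set l := _ / _; set lam := fun n => stake _ _ _ => cvl.
have ab0 : 0 < a + b by lra.
have lab : l * (a + b) = (b - a) / 2 by rewrite /l; field; rewrite gt_eqF.
have l0 : 0 < l by nra.
have l1 : l < 1 by nra.
have := half_kelly_growth_gt0 a0 ab lab; set D := _ - _ => D0.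
have lam_bounds n : 0 <= lam n <= 2^-1 by exact: stake_bounds.
(* Worsening both rates by [eta] costs [eta * (a + b) = D / 2], half of the growth rate. *)
pose eta := D / (2 * (a + b)).
have eta0 : 0 < eta by rewrite divr_gt0 ?mulr_gt0.
pose L := l / (1 + l) - eta; pose V := l / (1 - l) + eta.
have LV : b * L - a * V = D / 2.
  have : eta * (a + b) = D / 2 by rewrite /eta; field; rewrite gt_eqF.
  by rewrite /L /V /D; lra.
have nearL : \forall n \near \oo, L < lam n / (1 + lam n).
  apply: (cvgr_gt (l / (1 + l))); last by rewrite /L; lra.
  apply: cvgM => //; apply: cvgV; first by rewrite gt_eqF; lra.
  by apply: cvgD => //; exact: cvg_cst.
have nearV : \forall n \near \oo, lam n / (1 - lam n) < V.
  apply: (cvgr_lt (l / (1 - l))); last by rewrite /V; lra.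
  apply: cvgM => //; apply: cvgV; first by rewrite gt_eqF; lra.
  by apply: cvgB => //; exact: cvg_cst.
have [K _ nearK] : \forall n \near \oo,
    L < lam n / (1 + lam n) /\ lam n / (1 - lam n) < V.
  exact: filterI.
pose W n := wealth R m (mkseq x n).
pose N j n : R := (count_mem j (mkseq x n))%:R.
(* From time [K] on, log-wealth rises by at least [L] at each win and falls by at most [V] at each
   loss, so it grows at least as fast as [pot]. *)
pose pot n := L * N (m%:Z + 1) n - V * N m%:Z n.
have step n : (K <= n)%N -> W n * expR (pot n.+1 - pot n) <= W n.+1.
  move=> Kn; have [ltL ltV] := nearK _ Kn.
  have /andP[lam0 lam1] := lam_bounds n.
  have mkS : mkseq x n.+1 = rcons (mkseq x n) (x n).
    by rewrite /mkseq -addn1 iotaD map_cat cats1.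
  have NS j : N j n.+1 = N j n + (x n == j)%:R.
    by rewrite /N mkS -cats1 count_cat/= addn0 natrD.
  rewrite /W mkS wealth_rcons ler_wpM2l ?wealth_ge0// empirical_betE -/(lam n).
  rewrite /pot !NS.
  have -> (u v s t : R) : L * (u + s) - V * (v + t) - (L * u - V * v) = L * s - V * t.
    by ring.
  have [->|xm] := eqVneq (x n) m%:Z.
    have -> : (m%:Z == m%:Z + 1) = false by apply/negbTE; lia.
    rewrite mulr0 mulr1 sub0r addr0 mulrN1.
    by apply: le_trans (expR_le_1B _); rewrite ?ler_expR ?lerN2; lra.
  rewrite oppr0 add0r mulr0 subr0.
  have [_|_] := eqVneq (x n) (m%:Z + 1); last by rewrite !mulr0 expR0 addr0.
  by rewrite !mulr1; apply: le_trans (expR_le_1D _); rewrite ?ler_expR; lra.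
pose C := W K * expR (- pot K).
have C0 : 0 < C by rewrite mulr_gt0 ?expR_gt0 ?wealth_gt0.
have lower n : (K <= n)%N -> C * expR (pot n) <= W n.
  move=> /subnK <-; elim: (n - K)%N => [|k IH].
    by rewrite add0n /C -mulrA -expRD addNr expR0 mulr1.
  apply: le_trans (step _ (leq_addl _ _)).
  have -> : C * expR (pot (k.+1 + K)%N) =
      C * expR (pot (k + K)%N) * expR (pot (k + K).+1 - pot (k + K)%N).
    by rewrite -mulrA -expRD addrC subrK.
  by rewrite ler_wpM2r ?expR_ge0.
have cvpot : pot n / n%:R @[n --> \oo] --> D / 2.
  rewrite -LV (mulrC b) (mulrC a).
  rewrite [X in X @ _ --> _](_ : _ = fun n =>
      L * (N (m%:Z + 1) n / n%:R) - V * (N m%:Z n / n%:R)).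
    by apply: cvgB; apply: cvgMr.
  by apply/funext => n; rewrite /pot mulrBl !mulrA.
(* [pot n / n] tends to [D / 2], hence eventually exceeds [D / 4]; the last halving absorbs [C]. *)
exists (D / 4 / 2); first by rewrite !divr_gt0.
near=> n.
have n0 : 0 < n%:R :> R by rewrite ltr0n; near: n; exact: nbhs_infty_gt.
have potn : D / 4 * n%:R <= pot n.
  rewrite -ler_pdivlMr// ltW//; near: n; apply: (cvgr_gt (D / 2)) => //; lra.
apply: le_trans (lower n _); last by near: n; exact: nbhs_infty_ge.
apply: (@le_trans _ _ (C * expR (D / 4 * n%:R))).
  by near: n; apply: expR_dominates => //; rewrite divr_gt0.
by rewrite ler_pM2l// ler_expR.
Unshelve. all: by end_near. Qed.

End growth.

(** * Growth of the mixture and of its minimum over the modes *)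

Section divergence.
Context (R : realType).

Lemma J_ge_term theta m (s : seq int) :
  ((2 ^- (m + 2) * J_plus R theta m s)%:E <= J R theta s)%E /\
  ((2 ^- (m + 2) * J_minus R theta m s)%:E <= J R theta s)%E.
Proof.
have p0 : 0 <= J_plus R theta m s by exact: wealth_ge0.
have n0 : 0 <= J_minus R theta m s by exact: wealth_ge0.
have c0 k : 0 <= 2 ^- (k + 2) :> R by rewrite invr_ge0 exprn_ge0.
have t0 k : (0 <= (2 ^- (k + 2) * (J_plus R theta k s + J_minus R theta k s))%:E)%E.
  by rewrite lee_fin mulr_ge0// addr_ge0// wealth_ge0.
suff : ((2 ^- (m + 2) * (J_plus R theta m s + J_minus R theta m s))%:E
    <= J R theta s)%E.
  by move=> h; split; apply: le_trans h; rewrite lee_fin ler_wpM2l// ?lerDl ?lerDr.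
by rewrite /J (nneseriesD1 (n := m))// leeDl// nneseries_ge0.
Qed.

Lemma not_unimodalP theta (Q : probability int R) : ~ unimodal theta Q ->
  exists m : nat, mass Q (theta + m%:Z) < mass Q (theta + m%:Z + 1) \/
                  mass Q (theta - m%:Z) < mass Q (theta - m%:Z - 1).
Proof.
move=> /not_andP[] /existsNP[n /not_implyP[len /negP]]; rewrite -ltNge => h.
  (* The index of the bet is the distance from [theta] to the point where monotonicity fails. *)
  by exists `|theta - n|%N; right; rewrite gez0_abs ?subr_ge0// subKr.
by exists `|n - theta|%N; left; rewrite gez0_abs ?subr_ge0// subrKC.
Qed.

Section almost_sure.
Context d (T : measurableType d) (Pr : probability T R).
Variables (X : nat -> {RV Pr >-> int}) (Q : probability int R).
Hypothesis iidX : iid X Q.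

(** Injectivity of [f] preserves counts, so the relabelled path has the limiting frequencies of [a]
    and [b] at [m] and [m + 1]. *)
Lemma ae_wealth_growth (f : int -> int) (a b : int) m :
  injective f -> f a = m%:Z -> f b = m%:Z + 1 -> mass Q a < mass Q b ->
  {ae Pr, forall w, exists2 delta : R, 0 < delta & \forall n \near \oo,
    expR (delta * n%:R) <= wealth R m (map f (sample X n w))}.
Proof.
move=> injf fa fb ab.
apply: filterS2 (frequency_cvg iidX a) (frequency_cvg iidX b) => w cva cvb.
have mapE n : map f (sample X n w) = mkseq (fun i => f (X i w)) n.
  by rewrite /sample -map_comp.
have countE c n : count_mem c (sample X n w) =
    count_mem (f c) (mkseq (fun i => f (X i w)) n).
  by rewrite -mapE [RHS]count_map; apply: eq_count => x /=; rewrite (inj_eq injf).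
have [||delta delta0 growth] :=
  wealth_growth (x := fun i => f (X i w)) (m := m) (mass_ge0 Q a) ab.
- by move: cva; under eq_fun do rewrite countE fa.
- by move: cvb; under eq_fun do rewrite countE fb.
by exists delta => //; apply: filterS growth => n; rewrite mapE.
Qed.

Lemma ae_J_growth theta : ~ unimodal theta Q ->
  {ae Pr, forall w, exists2 delta : R, 0 < delta & \forall n \near \oo,
    ((expR (delta * n%:R))%:E <= J R theta (sample X n w))%E}.
Proof.
move=> /not_unimodalP[m viol].
(* A single growing term carries the whole mixture, its weight being absorbed by halving the
   rate. *)
have scale (V : seq int -> R) :
    (forall s, (2 ^- (m + 2) * V s)%:E <= J R theta s)%E ->
    {ae Pr, forall w, exists2 delta : R, 0 < delta &
      \forall n \near \oo, expR (delta * n%:R) <= V (sample X n w)} ->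
    {ae Pr, forall w, exists2 delta : R, 0 < delta & \forall n \near \oo,
      ((expR (delta * n%:R))%:E <= J R theta (sample X n w))%E}.
  move=> VJ; apply: filterS => w [delta delta0 growth].
  have c0 : 0 < 2 ^- (m + 2) :> R by rewrite invr_gt0 exprn_gt0.
  exists (delta / 2); first by rewrite divr_gt0.
  apply: filterS2 growth (expR_dominates c0 delta0) => n gn domn.
  apply: le_trans (VJ _); rewrite lee_fin; apply: le_trans domn _.
  by rewrite ler_pM2l.
case: viol => viol.
  apply: (scale (J_plus R theta m)) => [s|]; first by case: (J_ge_term theta m s).
  apply: (ae_wealth_growth _ _ _ viol); [exact: addIr|lia|lia].
apply: (scale (J_minus R theta m)) => [s|]; first by case: (J_ge_term theta m s).
apply: (ae_wealth_growth _ _ _ viol); [|lia|lia].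
by move=> x y /addrI /oppr_inj.
Qed.

End almost_sure.

Lemma J_min_ge (Theta : {fset int}) s (c : \bar R) :
  (forall theta, theta \in Theta -> c <= J R theta s)%E ->
  (c <= J_min R Theta s)%E.
Proof.
move=> h; rewrite /J_min big_seq; apply: le_bigmin => //; exact: leey.
Qed.

Lemma J_min_le (Theta : {fset int}) theta s :
  theta \in Theta -> (J_min R Theta s <= J R theta s)%E.
Proof. by move=> ?; apply: ge_bigmin_seq. Qed.

(** Here finiteness of the set of modes enters: finitely many positive rates have a positive
    minimum. *)
Lemma uniform_growth_rate (I : eqType) (r : seq I) (u : I -> nat -> \bar R) :
  (forall i, i \in r -> exists2 delta : R, 0 < delta &
    \forall n \near \oo, ((expR (delta * n%:R))%:E <= u i n)%E) ->
  exists2 delta : R, 0 < delta & \forall n \near \oo,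
    forall i, i \in r -> ((expR (delta * n%:R))%:E <= u i n)%E.
Proof.
elim: r => [_|i r IH h]; first by exists 1 => //; apply: nearW.
have [|d1 d10 h1] := h i; first by rewrite mem_head.
have [|d2 d20 h2] := IH; first by move=> j jr; apply: h; rewrite in_cons jr orbT.
exists (Num.min d1 d2); first by rewrite lt_min d10.
apply: filterS2 h1 h2 => n h1 h2 j; rewrite in_cons => /predU1P[->|jr].
  by apply: le_trans h1; rewrite lee_fin ler_expR ler_wpM2r// ge_min lexx.
by apply: le_trans (h2 j jr); rewrite lee_fin ler_expR ler_wpM2r// ge_min lexx orbT.
Qed.

Lemma limn_einf_lne_gt0 (u : nat -> \bar R) (delta : R) : 0 < delta ->
  (\forall n \near \oo, ((expR (delta * n%:R))%:E <= u n)%E) ->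
  (0 < limn_einf (fun n => n%:R^-1%:E * lne (u n)))%E.
Proof.
move=> delta0 growth; apply: (@lt_le_trans _ _ delta%:E); first by rewrite lte_fin.
rewrite limn_einf_lim; apply: lime_ge; first exact: is_cvg_einfs.
(* Tails start at 1 or later, which keeps [k%:R] invertible. *)
have [N _ hN] := growth; exists (maxn N 1) => // n /=.
rewrite geq_max => /andP[Nn n0]; apply: le_ereal_inf_tmp => _ [k /= nk <-].
have Nk := leq_trans Nn nk; have k0 : 0 < k%:R :> R by rewrite ltr0n (leq_trans n0).
have -> : delta%:E = (k%:R^-1%:E * (delta * k%:R)%:E)%E.
  by rewrite -EFinM mulrCA mulVf ?mulr1// gt_eqF.
rewrite lee_wpmul2l ?lee_fin ?invr_ge0 ?(ltW k0)//.
have uk := hN _ Nk.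
have e0 := expR_gt0 (delta * k%:R).
have <- : lne (expR (delta * k%:R))%:E = (delta * k%:R)%:E.
  by rewrite lne_EFin// expRK.
rewrite lee_lne ?in_itv/= ?leey ?andbT ?lee_fin ?(ltW e0)//.
by apply: le_trans uk; rewrite lee_fin ltW.
Qed.

End divergence.

Theorem corollary2p5 (R : realType) (Theta : {fset int}) (hTheta : Theta != fset0) :
  (forall Q : probability int R, ~ unimodal_mode_in Theta Q ->
   forall (d : measure_display) (T : measurableType d) (Pr : probability T R)
     (X : nat -> {RV Pr >-> int}), iid X Q ->
   {ae Pr, forall w,
     (0 < limn_einf (fun n => n%:R^-1%:E * lne (J_min R Theta (sample X n w))))%E})
  /\ e_process (unimodal_mode_in Theta) (@J_min R Theta).
Proof.
split.
  move=> Q notQ d T Pr X iidX.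
  (* [Q] is unimodal about no [theta] in [Theta], so each [J theta] grows; finitely many null sets
     are discarded. *)
  have /filter_bigI : forall theta, theta \in Theta ->
      {ae Pr, forall w, exists2 delta : R, 0 < delta & \forall n \near \oo,
        ((expR (delta * n%:R))%:E <= J R theta (sample X n w))%E}.
    move=> theta inTheta; apply: ae_J_growth iidX _ _ => unimodQ.
    by apply: notQ; exists theta.
  apply: filterS => w growth.
  have [delta delta0 h] := uniform_growth_rate
    (u := fun theta n => J R theta (sample X n w)) growth.
  apply: limn_einf_lne_gt0 delta0 _; apply: filterS h => n; exact: J_min_ge.
split=> [s|P [theta /= inTheta unimodP] d T Pr X iidXP tau tauX _].
  by apply: J_min_ge => theta _; exact: J_ge0.
(* The dominating supermartingale is [J theta] for a mode [theta] of [P] in [Theta]; its starting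
   value is the bound 1. *)
rewrite -(J_nil R theta); apply: optional_stopping_le tauX.
- by move=> s; apply: J_min_ge => ? _; exact: J_ge0.
- by move=> s; exact: J_min_le.
- by move=> n S; exact: J_supermartingale iidXP unimodP.
Qed.
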